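(* The proof system $\mathsf{EDL}_n$ is sound and complete with respect to the class $\mathcal{H}_n^{sut}$ of all simple, $n$-uniform and tail-complete hypergraph models. That is, for every formula $\varphi\in\mathcal{L}_B^K$: $\mathsf{EDL}_n\vdash\varphi$ if and only if $\varphi$ is valid in $\mathcal{H}_n^{sut}$ (i.e. $M,E\models\varphi$ for every $M=(G,\chi,\ell)\in\mathcal{H}_n^{sut}$ and every hyperedge $E$ of $G$).
   Context: Agents and language. Fix a set $\mathcal{A}$ of $n\geq 1$ agents (finite, $|\mathcal{A}|=n$). Each $a\in\mathcal{A}$ has a countable set $\mathsf{Var}_a$ of propositional letters (the local variables of $a$); these sets are pairwise disjoint, and $\mathsf{Var}:=\bigcup_{a\in\mathcal{A}}\mathsf{Var}_a$. The language $\mathcal{L}_B^K$ is generated by $\varphi::=p\mid\neg\varphi\mid\varphi\wedge\varphi\mid B_a\varphi\mid K_a\varphi$ with $p\in\mathsf{Var}$, $a\in\mathcal{A}$. Put $\varphi\vee\psi:=\neg(\neg\varphi\wedge\neg\psi)$, $\varphi\to\psi:=\neg\varphi\vee\psi$. Proof system $\mathsf{EDL}_n$. Axioms: all instances of classical tautologies, and all instances (for all $a\in\mathcal{A}$, $\varphi,\psi\in\mathcal{L}_B^K$) of: $B_a(\varphi\to\psi)\to(B_a\varphi\to B_a\psi)$; $K_a(\varphi\to\psi)\to(K_a\varphi\to K_a\psi)$; $\neg B_a(\varphi\wedge\neg\varphi)$; $B_a\varphi\to B_aB_a\varphi$; $\neg B_a\varphi\to B_a\neg B_a\varphi$; $K_a\varphi\to\varphi$;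 $K_a\varphi\to K_aK_a\varphi$; $\neg K_a\varphi\to K_a\neg K_a\varphi$; $B_a\varphi\to K_aB_a\varphi$; $\neg B_a\varphi\to K_a\neg B_a\varphi$; $K_a\varphi\to B_a\varphi$; and $(p\to B_ap)\wedge(\neg p\to B_a\neg p)$ for $p\in\mathsf{Var}_a$. Rules: modus ponens (from $\varphi$ and $\varphi\to\psi$ infer $\psi$) and necessitation (from $\varphi$ infer $K_a\varphi$). $\mathsf{EDL}_n\vdash\varphi$ means there is a finite sequence of formulas ending with $\varphi$, each of which is an axiom or follows from earlier ones by a rule. Hypergraphs. A directed hyperedge over a set $\mathscr{V}$ is a pair $E=(X,Y)$ of finite disjoint (possibly empty) subsets of $\mathscr{V}$; $T(E):=X$ (tail), $H(E):=Y$ (head), $U(E):=T(E)\cup H(E)$. A directed hypergraph is a pair $G=(\mathscr{V}(G),\mathscr{E}(G))$ with $\mathscr{V}(G)$ a non-empty set of vertices and $\mathscr{E}(G)$ a set of directed hyperedges over $\mathscr{V}(G)$. $G$ is simple if for all $E_1,E_2\in\mathscr{E}(G)$, $E_1\neq E_2$ implies $U(E_1)\not\subseteq U(E_2)$; $k$-uniform if $|U(E)|=k$ for all $E\in\mathscr{E}(G)$; tail-complete if $\mathscr{V}(G)=\bigcup_{E\in\mathscr{E}(G)}T(E)$. A coloring of $G$ is a map $\chi:\mathscr{V}(G)\to\mathcal{A}$ such that for every $E\in\mathscr{E}(G)$ and all distinct $u,v\in U(E)$, $\chi(u)\neq\chi(v)$. A hypergraph model is a triple $M=(G,\chi,\ell)$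 with $G$ a directed hypergraph, $\chi$ a coloring of $G$, and $\ell:\mathscr{V}(G)\to\mathcal{P}(\mathsf{Var})$ such that $\chi(u)=a$ implies $\ell(u)\subseteq\mathsf{Var}_a$. It is simple ($n$-uniform, tail-complete) if $G$ is. For $E\in\mathscr{E}(G)$ put $\ell(E):=\bigcup_{u\in U(E)}\ell(u)$. Semantics. For $a\in\mathcal{A}$ and $E_1,E_2\in\mathscr{E}(G)$: $E_1\vartriangleright_aE_2$ iff some $u\in U(E_1)\cap T(E_2)$ has $\chi(u)=a$; $E_1\approx_aE_2$ iff some $u\in U(E_1)\cap U(E_2)$ has $\chi(u)=a$. Satisfaction: $M,E\models p$ iff $p\in\ell(E)$; $\neg,\wedge$ as usual; $M,E\models B_a\varphi$ iff $M,E'\models\varphi$ for all $E'\in\mathscr{E}(G)$ with $E\vartriangleright_aE'$; $M,E\models K_a\varphi$ iff $M,E'\models\varphi$ for all $E'\in\mathscr{E}(G)$ with $E\approx_aE'$. *)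

(* Defs.v *)
From HB Require Import structures.
From Stdlib Require List.
From mathcomp Require Import all_boot.
From mathcomp Require Import finmap.
From mathcomp Require Import classical_sets.

Set Implicit Arguments.
Unset Strict Implicit.
Unset Printing Implicit Defensive.

Local Open Scope fset_scope.
Local Open Scope classical_set_scope.

(** [Var a] is the set of local variables of [a]; forming the disjoint union
    makes these sets pairwise disjoint, and [tag p] is the owner of [p]. *)
Definition lvar (A : finType) (Var : A -> countType) : Type := {a : A & Var a}.

Inductive form (A : finType) (Var : A -> countType) : Type :=
| Atom of lvar Var
| Neg of form Var
| And of form Var & form Var
| Bel of A & form Var
| Kno of A & form Var.

Arguments Atom {A Var} p.

Definition Or (A : finType) (Var : A -> countType) (f g : form Var) : form Var :=
  Neg (And (Neg f) (Neg g)).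

Definition Imp (A : finType) (Var : A -> countType) (f g : form Var) : form Var :=
  Or (Neg f) g.

Inductive pform : Type :=
| PVar of nat
| PNeg of pform
| PAnd of pform & pform.

Fixpoint peval (v : nat -> bool) (t : pform) : bool :=
  match t with
  | PVar i => v i
  | PNeg t1 => ~~ peval v t1
  | PAnd t1 t2 => peval v t1 && peval v t2
  end.

Definition tautology (t : pform) : Prop := forall v, peval v t.

Fixpoint psubst (A : finType) (Var : A -> countType) (s : nat -> form Var)
    (t : pform) : form Var :=
  match t with
  | PVar i => s i
  | PNeg t1 => Neg (psubst s t1)
  | PAnd t1 t2 => And (psubst s t1) (psubst s t2)
  end.

Inductive EDL_axiom (A : finType) (Var : A -> countType) : form Var -> Prop :=
| ax_taut t s : tautology t -> EDL_axiom (psubst s t)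
| ax_BK a f g : EDL_axiom (Imp (Bel a (Imp f g)) (Imp (Bel a f) (Bel a g)))
| ax_KK a f g : EDL_axiom (Imp (Kno a (Imp f g)) (Imp (Kno a f) (Kno a g)))
| ax_BD a f : EDL_axiom (Neg (Bel a (And f (Neg f))))
| ax_B4 a f : EDL_axiom (Imp (Bel a f) (Bel a (Bel a f)))
| ax_B5 a f : EDL_axiom (Imp (Neg (Bel a f)) (Bel a (Neg (Bel a f))))
| ax_KT a f : EDL_axiom (Imp (Kno a f) f)
| ax_K4 a f : EDL_axiom (Imp (Kno a f) (Kno a (Kno a f)))
| ax_K5 a f : EDL_axiom (Imp (Neg (Kno a f)) (Kno a (Neg (Kno a f))))
| ax_KB4 a f : EDL_axiom (Imp (Bel a f) (Kno a (Bel a f)))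
| ax_KB5 a f : EDL_axiom (Imp (Neg (Bel a f)) (Kno a (Neg (Bel a f))))
| ax_KB a f : EDL_axiom (Imp (Kno a f) (Bel a f))
| ax_loc (p : lvar Var) :
    EDL_axiom (And (Imp (Atom p) (Bel (tag p) (Atom p)))
                   (Imp (Neg (Atom p)) (Bel (tag p) (Neg (Atom p))))).

Definition EDL_step (A : finType) (Var : A -> countType) (s : seq (form Var))
    (f : form Var) : Prop :=
  [\/ EDL_axiom f,
      exists2 g, List.In g s & List.In (Imp g f) s
    | exists a g, List.In g s /\ f = Kno a g].

Definition EDL_derivation (A : finType) (Var : A -> countType)
    (s : seq (form Var)) : Prop :=
  forall s1 f s2, s = s1 ++ f :: s2 -> EDL_step s1 f.

Definition EDL_provable (A : finType) (Var : A -> countType) (f : form Var) : Prop :=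
  exists s, EDL_derivation (rcons s f).

(** Classically every type carries a [choiceType] structure, so taking vertices
    in a [choiceType] is no restriction; it gives access to [{fset V}]. *)
Record dhyperedge (V : choiceType) : Type := DHyperedge {
  etail : {fset V};
  ehead : {fset V};
  etail_ehead_disjoint : [disjoint etail & ehead]%fset }.

Definition uset (V : choiceType) (E : dhyperedge V) : {fset V} :=
  (etail E `|` ehead E)%fset.

Record dhypergraph : Type := DHypergraph {
  vertex : choiceType;
  vertex_nonempty : inhabited vertex;
  edges : set (dhyperedge vertex) }.

Definition simple (G : dhypergraph) : Prop :=
  forall E1 E2 : dhyperedge (vertex G), edges E1 -> edges E2 ->
    E1 <> E2 -> ~ (uset E1 `<=` uset E2)%fset.

Definition uniform (k : nat) (G : dhypergraph) : Prop :=
  forall E : dhyperedge (vertex G), edges E -> #|` uset E| = k.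

Definition tail_complete (G : dhypergraph) : Prop :=
  [set: vertex G] = \bigcup_(E in @edges G) [set` etail E].

Definition is_coloring (A : finType) (G : dhypergraph) (coloring : vertex G -> A) : Prop :=
  forall E : dhyperedge (vertex G), edges E ->
    forall u v, u \in uset E -> v \in uset E -> u <> v -> coloring u <> coloring v.

Record hmodel (A : finType) (Var : A -> countType) : Type := HModel {
  graph : dhypergraph;
  coloring : vertex graph -> A;
  coloringP : is_coloring coloring;
  label : vertex graph -> set (lvar Var);
  labelP : forall u, label u `<=` [set p | tag p = coloring u] }.

Definition hyperedge (A : finType) (Var : A -> countType) (M : hmodel Var) : Type :=
  dhyperedge (vertex (graph M)).

Definition edge_label (A : finType) (Var : A -> countType) (M : hmodel Var)
    (E : hyperedge M) : set (lvar Var) :=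
  \bigcup_(u in [set` uset E]) label u.

Definition rel_B (A : finType) (Var : A -> countType) (M : hmodel Var) (a : A)
    (E1 E2 : hyperedge M) : Prop :=
  exists2 u, u \in (uset E1 `&` etail E2)%fset & coloring u = a.

Definition rel_K (A : finType) (Var : A -> countType) (M : hmodel Var) (a : A)
    (E1 E2 : hyperedge M) : Prop :=
  exists2 u, u \in (uset E1 `&` uset E2)%fset & coloring u = a.

Fixpoint sat (A : finType) (Var : A -> countType) (M : hmodel Var)
    (E : hyperedge M) (f : form Var) : Prop :=
  match f with
  | Atom p => edge_label E p
  | Neg f1 => ~ sat E f1
  | And f1 f2 => sat E f1 /\ sat E f2
  | Bel a f1 => forall E' : hyperedge M, edges E' -> rel_B a E E' -> sat E' f1
  | Kno a f1 => forall E' : hyperedge M, edges E' -> rel_K a E E' -> sat E' f1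
  end.

Definition H_sut (A : finType) (Var : A -> countType) (n : nat) (M : hmodel Var) : Prop :=
  [/\ simple (graph M), uniform n (graph M) & tail_complete (graph M)].

Definition valid_in (A : finType) (Var : A -> countType) (C : hmodel Var -> Prop)
    (f : form Var) : Prop :=
  forall M : hmodel Var, C M -> forall E : hyperedge M, edges E -> sat E f.

(* Main.v *)
Require Import Defs.
From mathcomp Require Import all_boot.
From HB Require Import structures.
From Stdlib Require List.
From mathcomp Require Import finmap.
From mathcomp Require Import boolp classical_sets.

(** Completeness uses the canonical model, whose worlds are the maximal
    consistent sets.  Its vertices are the pairs of an agent [a] and the set of
    formulas that [a] knows at some world, and the world [w] yields the hyperedge
    made of the vertices of all agents at [w]; the vertex of [a] is put in the
    tail iff everything [a] believes at [w] is true at [w].  This hypergraph is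
    simple without any unravelling: every atom is local to some agent, so a world
    is determined by what the agents know there. *)

Set Implicit Arguments.
Unset Strict Implicit.
Unset Printing Implicit Defensive.

Local Open Scope classical_set_scope.

(** * Soundness: the relations [rel_B] and [rel_K], and the axioms *)

Section Soundness.
Variables (A : finType) (Var : A -> countType) (M : hmodel Var).
Implicit Types (E : hyperedge M) (f g : form Var) (a : A).

Lemma sat_Imp E f g : sat E (Imp f g) <-> (sat E f -> sat E g).
Proof.
split=> [h hf|h] /=; last tauto.
by apply: contrapT => hg; apply: h; split => //; apply.
Qed.

Lemma sat_psubst E (s : nat -> form Var) (t : pform) :
  sat E (psubst s t) <-> peval (fun i => `[< sat E (s i) >]) t.
Proof.
elim: t => [i|t IH|t1 IH1 t2 IH2] /=.
- by split=> /asboolP.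
- by rewrite IH; split=> /negP.
- by rewrite IH1 IH2; split=> /andP.
Qed.

Lemma coloring_inj E u v : edges E -> u \in uset E -> v \in uset E ->
  coloring u = coloring v -> u = v.
Proof.
move=> hE hu hv huv; apply: contrapT => /(coloringP hE hu hv).
by rewrite huv.
Qed.

Lemma rel_K_sym a E1 E2 : rel_K a E1 E2 -> rel_K a E2 E1.
Proof. by case=> u hu hc; exists u => //; rewrite fsetIC. Qed.

(** Distinct vertices of [E2] have distinct colours, so the two witnessing vertices of colour [a]
    coincide. The same argument composes [rel_K] with [rel_B] below. *)
Lemma rel_K_trans a E1 E2 E3 : edges E2 ->
  rel_K a E1 E2 -> rel_K a E2 E3 -> rel_K a E1 E3.
Proof.
move=> hE [u /fsetIP[u1 u2] uc] [v /fsetIP[v2 v3] vc].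
have uv : u = v by apply: (coloring_inj hE) => //; rewrite uc.
by exists u => //; apply/fsetIP; split=> //; rewrite uv.
Qed.

Lemma rel_K_rel_B a E1 E2 E3 : edges E2 ->
  rel_K a E1 E2 -> rel_B a E2 E3 -> rel_B a E1 E3.
Proof.
move=> hE [u /fsetIP[u1 u2] uc] [v /fsetIP[v2 v3] vc].
have uv : u = v by apply: (coloring_inj hE) => //; rewrite uc.
by exists u => //; apply/fsetIP; split=> //; rewrite uv.
Qed.

Lemma rel_BW a E1 E2 : rel_B a E1 E2 -> rel_K a E1 E2.
Proof.
case=> u /fsetIP[u1 u2] uc; exists u => //; apply/fsetIP; split=> //.
by rewrite in_fsetU u2.
Qed.

(** Labels respect colours, so only the vertex of agent [tag p] can carry [p], and the two edges
    share that vertex. *)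
Lemma edge_label_rel_K p E1 E2 : edges E1 -> rel_K (tag p) E1 E2 ->
  edge_label E1 p -> edge_label E2 p.
Proof.
move=> hE [u /fsetIP[u1 u2] uc] [v v1 vp].
have uv : u = v.
  by apply: (coloring_inj hE) => //; rewrite uc (labelP vp).
by exists u; rewrite ?uv // -uv.
Qed.

Hypothesis M_uniform : uniform #|A| (graph M).
Hypothesis M_tail_complete : tail_complete (graph M).

(** Pigeonhole: an edge has [#|A|] vertices with pairwise distinct colours, so every colour
    occurs. *)
Lemma colored_vertex a E : edges E -> exists2 u, u \in uset E & coloring u = a.
Proof.
move=> hE; pose s := [seq coloring u | u <- uset E].
have s_uniq : uniq s.
  rewrite map_inj_in_uniq ?fset_uniq // => u v hu hv.
  exact: (coloring_inj hE).
have s_size : #|A| <= size s by rewrite size_map M_uniform.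
have : a \in s.
  have [//|a_s] := boolP (a \in s).
  have := max_card [in a :: s].
  by rewrite (card_uniqP _) /= ?a_s // ltnNge s_size.
by case/mapP=> u hu ->; exists u.
Qed.

Lemma rel_K_refl a E : edges E -> rel_K a E E.
Proof.
by move=> /(colored_vertex a)[u hu uc]; exists u => //; rewrite fsetIid.
Qed.

Lemma rel_B_serial a E : edges E -> exists2 E', edges E' & rel_B a E E'.
Proof.
move=> /(colored_vertex a)[u hu uc].
have : [set: vertex (graph M)] u by [].
rewrite M_tail_complete => -[E' hE' uE']; exists E' => //.
by exists u => //; apply/fsetIP.
Qed.

Lemma axiom_sound f : EDL_axiom f -> forall E, edges E -> sat E f.
Proof.
case=> {f}.
- by move=> t s ht E _; apply/sat_psubst/ht.
- move=> a f g E _; do 2!apply/sat_Imp => ?.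
  by move=> E' hE' r; apply: (sat_Imp _ _ _).1; auto.
- move=> a f g E _; do 2!apply/sat_Imp => ?.
  by move=> E' hE' r; apply: (sat_Imp _ _ _).1; auto.
- by move=> a f E /(rel_B_serial a)[E' hE' r] /(_ _ hE' r) /= [].
- move=> a f E hE; apply/sat_Imp => h E1 hE1 r1 E2 hE2 r2.
  exact/h/(rel_K_rel_B hE1 (rel_BW r1) r2).
(* Negative introspection: [E] and [E1] share their vertex of colour [a], so a belief held at [E1]
   would already be held at [E]. *)
- move=> a f E hE; apply/sat_Imp => h E1 hE1 r1 h1; apply: h => E2 hE2 r2.
  exact/h1/(rel_K_rel_B hE (rel_K_sym (rel_BW r1)) r2).
- by move=> a f E hE; apply/sat_Imp; apply => //; exact: rel_K_refl.
- move=> a f E hE; apply/sat_Imp => h E1 hE1 r1 E2 hE2 r2.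
  exact/h/(rel_K_trans hE1 r1 r2).
- move=> a f E hE; apply/sat_Imp => h E1 hE1 r1 h1; apply: h => E2 hE2 r2.
  exact/h1/(rel_K_trans hE (rel_K_sym r1) r2).
- move=> a f E hE; apply/sat_Imp => h E1 hE1 r1 E2 hE2 r2.
  exact/h/(rel_K_rel_B hE1 r1 r2).
- move=> a f E hE; apply/sat_Imp => h E1 hE1 r1 h1; apply: h => E2 hE2 r2.
  exact/h1/(rel_K_rel_B hE (rel_K_sym r1) r2).
- by move=> a f E hE; apply/sat_Imp => h E1 hE1 /rel_BW; exact: h.
- move=> p E hE; split; apply/sat_Imp => /= h E1 hE1 /rel_BW r.
    exact: edge_label_rel_K h.
  by apply: contra_not h; apply: edge_label_rel_K (rel_K_sym r).
Qed.

End Soundness.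

(** * Derivations: closure properties and induction *)

Section Provability.
Variables (A : finType) (Var : A -> countType).
Implicit Types (f g h : form Var) (s t : seq (form Var)).

Lemma EDL_derivation_rcons s f :
  EDL_derivation (rcons s f) <-> EDL_derivation s /\ EDL_step s f.
Proof.
split=> [d|[d st] s1 g s2].
  split; last by apply: (d s f [::]); rewrite cats1.
  by move=> s1 g s2 e; apply: (d s1 g (rcons s2 f)); rewrite e rcons_cat.
case/lastP: s2 => [|s2 x]; first by rewrite cats1 => /rcons_inj[<- <-].
by rewrite -rcons_cons -rcons_cat => /rcons_inj[e _]; exact: d e.
Qed.

Lemma EDL_step_catl s t f : EDL_step t f -> EDL_step (s ++ t) f.
Proof.
have inr g : List.In g t -> List.In g (s ++ t).
  by move=> ?; apply/List.in_or_app; right.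
case=> [ax|[g g1 g2]|[a [g [g1 ->]]]].
- by constructor 1.
- by constructor 2; exists g; auto.
- by constructor 3; exists a, g; auto.
Qed.

Lemma EDL_derivation_cat s t :
  EDL_derivation s -> EDL_derivation t -> EDL_derivation (s ++ t).
Proof.
move=> ds; elim/last_ind: t => [|t f IH]; first by rewrite cats0.
rewrite -rcons_cat !EDL_derivation_rcons => -[/IH dt st].
by split=> //; exact: EDL_step_catl.
Qed.

Lemma In_rcons (T : Type) (x : T) (s : seq T) : List.In x (rcons s x).
Proof. by rewrite -cats1; apply/List.in_or_app; right; left. Qed.

Lemma provable_axiom f : EDL_axiom f -> EDL_provable f.
Proof.
move=> ax; exists [::]; apply/EDL_derivation_rcons; split; last by constructor 1.
by case.
Qed.

Lemma provable_MP f g : EDL_provable (Imp f g) -> EDL_provable f -> EDL_provable g.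
Proof.
move=> [s ds] [t dt]; exists (rcons s (Imp f g) ++ rcons t f).
apply/EDL_derivation_rcons; split; first exact: EDL_derivation_cat.
by constructor 2; exists f; apply/List.in_or_app; [right|left]; exact: In_rcons.
Qed.

Lemma provable_Kno a f : EDL_provable f -> EDL_provable (Kno a f).
Proof.
move=> [s ds]; exists (rcons s f); apply/EDL_derivation_rcons; split=> //.
by constructor 3; exists a, f; split=> //; exact: In_rcons.
Qed.

Lemma provable_Bel a f : EDL_provable f -> EDL_provable (Bel a f).
Proof. by move=> /(provable_Kno a); exact/provable_MP/provable_axiom/ax_KB. Qed.

Lemma provable_ind (P : form Var -> Prop) :
  (forall f, EDL_axiom f -> P f) ->
  (forall f g, P (Imp f g) -> P f -> P g) ->
  (forall a f, P f -> P (Kno a f)) ->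
  forall f, EDL_provable f -> P f.
Proof.
move=> Pax Pmp Pnec f [s d].
(* Generalized to all members of a derivation, since the premises of a step may occur anywhere
   before it. *)
suff /(_ _ d) : forall t, EDL_derivation t -> forall g, List.In g t -> P g.
  by apply; exact: In_rcons.
elim/last_ind => [//|t g IH] /EDL_derivation_rcons[/IH {}IH st] h.
rewrite -cats1 => /(List.in_app_or _ _ _)[/IH //|[<-|//]].
case: st => [/Pax //|[k k1 k2]|[a [k [k1 ->]]]].
- by apply: Pmp (IH _ k2) (IH _ k1).
- exact/Pnec/IH.
Qed.

Lemma provable_taut f0 s (t : pform) :
  tautology t -> EDL_provable (psubst (nth f0 s) t).
Proof. by move=> ht; apply: provable_axiom; constructor. Qed.

End Provability.

(** Mirrors the unfolding of [Imp], so that [psubst] maps it to [Imp] by computation. *)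
Definition PImp (t u : pform) : pform := PNeg (PAnd (PNeg (PNeg t)) (PNeg u)).

(** The schema [t] uses at most three letters and is checked by truth table; the head of [l] doubles
    as the default formula for the remaining letters. *)
Ltac taut t l :=
  match l with
  | (cons ?x _) => refine (@provable_taut _ _ x l t _)
  end;
  let v := fresh in
  intro v; simpl; case (v 0); case (v 1); try case (v 2); reflexivity.

(** * The propositional tautologies used for completeness *)

Section Tautologies.
Variables (A : finType) (Var : A -> countType).
Implicit Types f g h : form Var.
Let x := PVar 0.
Let y := PVar 1.
Let z := PVar 2.

Lemma provable_weak f g : EDL_provable (Imp f (Imp g f)).
Proof. taut (PImp x (PImp y x)) [:: f; g]. Qed.

Lemma provable_dist f g h :
  EDL_provable (Imp (Imp f (Imp g h)) (Imp (Imp f g) (Imp f h))).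
Proof.
taut (PImp (PImp x (PImp y z)) (PImp (PImp x y) (PImp x z))) [:: f; g; h].
Qed.

Lemma provable_refl f : EDL_provable (Imp f f).
Proof. taut (PImp x x) [:: f]. Qed.

Lemma provable_absurd f g : EDL_provable (Imp (Neg f) (Imp f g)).
Proof. taut (PImp (PNeg x) (PImp x y)) [:: f; g]. Qed.

Lemma provable_cases f g :
  EDL_provable (Imp (Imp f g) (Imp (Imp (Neg f) g) g)).
Proof. taut (PImp (PImp x y) (PImp (PImp (PNeg x) y) y)) [:: f; g]. Qed.

Lemma provable_andl f g : EDL_provable (Imp (And f g) f).
Proof. taut (PImp (PAnd x y) x) [:: f; g]. Qed.

Lemma provable_andr f g : EDL_provable (Imp (And f g) g).
Proof. taut (PImp (PAnd x y) y) [:: f; g]. Qed.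

Lemma provable_andI f g : EDL_provable (Imp f (Imp g (And f g))).
Proof. taut (PImp x (PImp y (PAnd x y))) [:: f; g]. Qed.

End Tautologies.

(** Necessitation is not applied to hypotheses, so that the deduction theorem holds. *)
Inductive entails (A : finType) (Var : A -> countType) (X : set (form Var)) :
    form Var -> Prop :=
| entails_hyp f : X f -> entails X f
| entails_provable f : EDL_provable f -> entails X f
| entails_MP f g : entails X (Imp f g) -> entails X f -> entails X g.

(** The two directions of [mc_Neg] are consistency and maximality. *)
Record max_consistent (A : finType) (Var : A -> countType) (w : set (form Var)) :
    Prop := MaxConsistent {
  mc_provable : forall f, EDL_provable f -> w f;
  mc_MP : forall f g, w (Imp f g) -> w f -> w g;
  mc_Neg : forall f, w (Neg f) <-> ~ w f }.

(** * Deduction theorem, Lindenbaum's lemma and existence of witnesses *)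

Section Lindenbaum.
Variables (A : finType) (Var : A -> countType).
Implicit Types (f g : form Var) (X Y : set (form Var)).

Lemma entails_sub X Y f : X `<=` Y -> entails X f -> entails Y f.
Proof.
move=> XY; elim=> {f} [f /XY|f|f g _ IHfg _ IHf].
- exact: entails_hyp.
- exact: entails_provable.
- exact: entails_MP IHfg IHf.
Qed.

Lemma deduction X f g : entails (f |` X) g -> entails X (Imp f g).
Proof.
elim=> {g} [g [->|Xg]|g pg|g h _ IHgh _ IHg].
- exact/entails_provable/provable_refl.
- exact: entails_MP (entails_provable _ (provable_weak _ _)) (entails_hyp Xg).
- apply/entails_provable; exact: provable_MP (provable_weak _ _) pg.
- apply: entails_MP IHg; apply: entails_MP IHgh.
  exact/entails_provable/provable_dist.
Qed.

(** An entailment uses finitely many hypotheses, and a chain has one member containing all those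
    taken from it. The first alternative also covers the empty chain. *)
Lemma entails_bigcup X (F : set (set (form Var))) f : total_on F subset ->
  entails (X `|` \bigcup_(Y in F) Y) f ->
  entails X f \/ exists2 Y, F Y & entails (X `|` Y) f.
Proof.
move=> totF; elim=> {f} [f [Xf|[Y FY Yf]]|f pf|f g _ IHfg _ IHf].
- by left; exact: entails_hyp.
- by right; exists Y => //; apply: entails_hyp; right.
- by left; exact: entails_provable.
- case: IHfg IHf => [e1|[Y1 F1 e1]] [e2|[Y2 F2 e2]].
  + by left; exact: entails_MP e1 e2.
  + right; exists Y2 => //; apply: entails_MP e2.
    by apply: entails_sub e1; left.
  + right; exists Y1 => //; apply: entails_MP e1 _.
    by apply: entails_sub e2; left.
  + right; case: (totF _ _ F1 F2) => Y12.
      exists Y2 => //; apply: entails_MP e2.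
      by apply: entails_sub e1; exact: setUS.
    exists Y1 => //; apply: entails_MP e1 _.
    by apply: entails_sub e2; exact: setUS.
Qed.

Lemma lindenbaum X f : ~ entails X f ->
  exists w, [/\ max_consistent w, X `<=` w & ~ w f].
Proof.
move=> nXf.
(* Zorn is applied to the additions [Y] to [X] rather than to supersets of [X], so that the union of
   the empty chain is admissible. *)
have [|Y [nYf Ymax]] := @Zorn_bigcup _ [set Y | ~ entails (X `|` Y) f].
  by move=> F FP totF /(entails_bigcup totF)[//|[Y /FP]].
pose w := entails (X `|` Y).
(* By maximality, adding [g] to [Y] makes [f] entailed. *)
have w_imp g : ~ w g -> w (Imp g f).
  move=> nwg; apply: deduction; apply: contrapT => nf.
  apply: (Ymax (g |` Y)); last by rewrite /= setUCA.
  split=> [h Yh|sub]; first by right.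
  by apply: nwg; apply: entails_hyp; right; apply: sub; left.
exists w; split=> //; last by move=> g Xg; apply: entails_hyp; left.
split=> [g|g h|g]; [exact: entails_provable|exact: entails_MP|].
split=> [wNg wg|nwg].
  apply: nYf; apply: entails_MP wg; apply: entails_MP wNg.
  exact/entails_provable/provable_absurd.
(* If [g] and its negation were both outside [w], both would imply [f], and [f] would follow by
   cases. *)
apply: contrapT => /w_imp nwNg; apply: nYf.
apply: entails_MP nwNg; apply: entails_MP (w_imp _ nwg).
exact/entails_provable/provable_cases.
Qed.

Lemma mc_And (w : set (form Var)) f g :
  max_consistent w -> w (And f g) <-> w f /\ w g.
Proof.
move=> mw; split=> [wfg|[wf wg]].
  split; apply: (mc_MP mw) wfg; apply: (mc_provable mw).
    exact: provable_andl.
  exact: provable_andr.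
apply: (mc_MP mw) wg; apply: (mc_MP mw) wf; apply: (mc_provable mw).
exact: provable_andI.
Qed.

(** Everything entailed by the formulas boxed in [w] is itself boxed in [w], so [f] is not entailed
    and Lindenbaum's lemma applies. Serves both modalities. *)
Lemma mc_box (box : form Var -> form Var) (w : set (form Var)) f :
  (forall g h, EDL_provable (Imp (box (Imp g h)) (Imp (box g) (box h)))) ->
  (forall g, EDL_provable g -> EDL_provable (box g)) ->
  max_consistent w -> ~ w (box f) ->
  exists w', [/\ max_consistent w', [set g | w (box g)] `<=` w' & ~ w' f].
Proof.
move=> boxK boxN mw nf; apply: lindenbaum; apply: contra_not nf.
elim=> {f} [//|f pf|f g _ IHfg _ IHf].
- exact/(mc_provable mw)/boxN.
- apply: (mc_MP mw) IHf; apply: (mc_MP mw) IHfg; apply: (mc_provable mw).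
  exact: boxK.
Qed.

Lemma mc_axiom (w : set (form Var)) f g :
  max_consistent w -> EDL_axiom (Imp f g) -> w f -> w g.
Proof. by move=> mw ax; apply: (mc_MP mw); exact/(mc_provable mw)/provable_axiom. Qed.

End Lindenbaum.

(** * Canonical worlds: knowledge, belief and atoms *)

Section CanonicalModel.
Variables (A : finType) (Var : A -> countType).
Implicit Types (f g : form Var) (a : A) (p : lvar Var).

Definition world : Type := {w : set (form Var) | max_consistent w}.
Implicit Types w : world.

Definition known a w : set (form Var) := [set f | sval w (Kno a f)].

(** Reflexivity of [w] for the canonical accessibility relation of belief. *)
Definition plausible a w : Prop := forall f, sval w (Bel a f) -> sval w f.

Lemma world_eq w w' : sval w = sval w' -> w = w'.
Proof. by case: w w' => [X mX] [Y mY]; exact: eq_exist. Qed.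

(** Positive introspection carries knowledge from [w] to [w'], negative introspection carries
    ignorance, so one inclusion suffices. *)
Lemma known_sub a w w' : (forall f, known a w f -> sval w' f) -> known a w = known a w'.
Proof.
move=> h; have [mw mw'] := (svalP w, svalP w').
apply/seteqP; split=> f kf.
  by apply: h; apply: (mc_axiom mw) kf; exact: ax_K4.
apply: contrapT => /(mc_Neg mw) nkf.
suff /(mc_Neg mw') : sval w' (Neg (Kno a f)) by [].
by apply: h; apply: (mc_axiom mw) nkf; exact: ax_K5.
Qed.

Lemma known_witness a w f : ~ sval w (Kno a f) ->
  exists2 w', known a w = known a w' & ~ sval w' f.
Proof.
move=> /(mc_box (fun g h => provable_axiom (ax_KK a g h)) (@provable_Kno _ _ a)
  (svalP w))[w' [mw' sub nf]].
by exists (exist _ w' mw') => //; exact: known_sub.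
Qed.

Lemma believed_witness a w f : ~ sval w (Bel a f) ->
  exists w', [/\ known a w = known a w', plausible a w' & ~ sval w' f].
Proof.
have mw := svalP w.
move=> /(mc_box (fun g h => provable_axiom (ax_BK a g h)) (@provable_Bel _ _ a)
  mw)[w' [mw' sub nf]].
exists (exist _ w' mw'); split=> //.
  by apply: known_sub => g kg; apply: sub; apply: (mc_axiom mw) kg; exact: ax_KB.
(* If [w] did not believe [g], it would believe that it does not, and [w'] would contain the
   negation of [Bel a g]. *)
move=> g /= w'Bg; apply: (sub); apply: contrapT => /(mc_Neg mw) nBg.
suff /(mc_Neg mw') : w' (Neg (Bel a g)) by [].
by apply: sub; apply: (mc_axiom mw) nBg; exact: ax_B5.
Qed.

(** [f0] rules out the degenerate case where there is no variable, hence no formula. *)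
Lemma plausible_exists f0 a w : exists2 w', known a w = known a w' & plausible a w'.
Proof.
have [|w' []] := @believed_witness a w (And f0 (Neg f0)); last by exists w'.
apply/(mc_Neg (svalP w))/(mc_provable (svalP w)).
exact/provable_axiom/ax_BD.
Qed.

(** Beliefs are known to be held, hence are determined by what is known. *)
Lemma believed_known a w w' f :
  known a w = known a w' -> sval w (Bel a f) -> sval w' (Bel a f).
Proof.
move=> kk wB; apply: (mc_axiom (svalP w') (ax_KT a _)).
suff : known a w (Bel a f) by rewrite kk.
by apply: (mc_axiom (svalP w)) wB; exact: ax_KB4.
Qed.

(** Locality is an axiom for belief only. If the owner did not know a true [p], an indistinguishable
    world would falsify [p]. Belief in [p] and in its negation would then both reach a plausible
    world with the same knowledge, and both be true there. *)
Lemma atom_known p w : known (tag p) w (Atom p) <-> sval w (Atom p).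
Proof.
set a := tag p; split=> [|wp]; first exact: (mc_axiom (svalP w) (ax_KT a _)).
have loc w1 :
    (sval w1 (Atom p) -> sval w1 (Bel a (Atom p))) /\
    (~ sval w1 (Atom p) -> sval w1 (Bel a (Neg (Atom p)))).
  have mw1 := svalP w1.
  have /(mc_And _ _ mw1)[l1 l2] := mc_provable mw1 (provable_axiom (ax_loc p)).
  split=> [|/(mc_Neg mw1)]; [exact: (mc_MP mw1 l1)|exact: (mc_MP mw1 l2)].
apply: contrapT => /known_witness[w1 k1 /(loc w1).2 B1].
have [w2 k2 pl2] := plausible_exists (Atom p) a w1.
have /pl2/(mc_Neg (svalP w2)) := believed_known k2 B1; apply; apply: pl2.
by apply: believed_known k2 _; apply: believed_known k1 _; exact: (loc w).1.
Qed.

Lemma known_inj w w' : (forall a, known a w = known a w') -> w = w'.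
Proof.
move=> kk; have [mw mw'] := (svalP w, svalP w').
apply: world_eq; apply/funext => f; apply/propext.
elim: f => [p|f IH|f IHf g IHg|a f _|a f _].
- by rewrite -[sval w _]atom_known -[sval w' _]atom_known kk.
- by rewrite (mc_Neg mw) (mc_Neg mw') IH.
- by rewrite (mc_And _ _ mw) (mc_And _ _ mw') IHf IHg.
- by split; apply: believed_known; rewrite kk.
- by rewrite -[sval w _]/(known a w f) -[sval w' _]/(known a w' f) kk.
Qed.

(** * The canonical hypergraph and its properties *)

(** The set must be known at an actual world, since tail-completeness requires an edge through every
    vertex. *)
Definition cvertex : Type :=
  {x : A * set (form Var) | exists w, x.2 = known x.1 w}.
HB.instance Definition _ := gen_eqMixin cvertex.
HB.instance Definition _ := gen_choiceMixin cvertex.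

Definition cvert w a : cvertex := exist _ (a, known a w) (ex_intro _ w erefl).

Lemma cvert_eq w w' a a' :
  cvert w a = cvert w' a' <-> a = a' /\ known a w = known a' w'.
Proof. by split=> [[-> ->]//|[e1 e2]]; apply: eq_exist; congr pair. Qed.

Lemma cvert_inj w : injective (cvert w).
Proof. by move=> a a' /cvert_eq[]. Qed.

Definition ctail w : {fset cvertex} :=
  [fset cvert w a | a in [pred a | `[< plausible a w >]]]%fset.
Definition chead w : {fset cvertex} :=
  [fset cvert w a | a in [pred a | ~~ `[< plausible a w >]]]%fset.

Lemma ctailP w w' a :
  reflect (known a w = known a w' /\ plausible a w) (cvert w' a \in ctail w).
Proof.
apply: (iffP (imfsetP _ _ _ _)) => [[b /= /asboolP pl /cvert_eq[-> ->]]//|[k pl]].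
by exists a; [exact/asboolP|exact/cvert_eq].
Qed.

Lemma ctail_chead_disjoint w : [disjoint ctail w & chead w]%fset.
Proof.
apply/fdisjointP => u /imfsetP[a /= /asboolP pl ->].
by apply/negP => /imfsetP[b /= /asboolPn npl /cvert_inj ab]; rewrite -ab in npl.
Qed.

Definition cedge w : dhyperedge cvertex := DHyperedge (ctail_chead_disjoint w).

Lemma usetE w : uset (cedge w) = [fset cvert w a | a in A]%fset.
Proof.
apply/fsetP => u; rewrite in_fsetU; apply/orP/imfsetP.
  by case=> /imfsetP[a _ ->]; exists a.
case=> a _ ->; have [pl|npl] := boolP `[< plausible a w >]; [left|right].
  by apply/imfsetP; exists a.
by apply/imfsetP; exists a.
Qed.

Lemma usetP w w' a :
  reflect (known a w = known a w') (cvert w' a \in uset (cedge w)).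
Proof.
rewrite usetE; apply: (iffP (imfsetP _ _ _ _)) => [[b _ /cvert_eq[-> ->]]//|k].
by exists a => //; exact/cvert_eq.
Qed.

Lemma mem_uset w (u : cvertex) : u \in uset (cedge w) -> u = cvert w (sval u).1.
Proof. by rewrite usetE => /imfsetP[a _ ->]. Qed.

Variable v0 : inhabited cvertex.

Definition cgraph : dhypergraph :=
  @DHypergraph cvertex v0 (range cedge).

Definition ccoloring (u : vertex cgraph) : A := (sval (u : cvertex)).1.

Lemma ccoloringP : is_coloring ccoloring.
Proof.
move=> _ [w _ <-] u v /mem_uset uE /mem_uset vE uv cuv; apply: uv.
by rewrite uE vE; congr cvert.
Qed.

Definition clabel (u : vertex cgraph) : set (lvar Var) :=
  [set p | tag p = ccoloring u /\ (sval (u : cvertex)).2 (Atom p)].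

Lemma clabelP u : clabel u `<=` [set p | tag p = ccoloring u].
Proof. by move=> p []. Qed.

Definition cmodel : hmodel Var := HModel ccoloringP clabelP.

Lemma cmodel_sut (f0 : form Var) : H_sut #|A| cmodel.
Proof.
split.
(* Inclusion puts each agent's vertex at [w] on the edge of [w'], so all agents know the same at
   both worlds. *)
- move=> _ _ [w _ <-] [w' _ <-] ww' /fsubsetP sub; apply: ww'.
  congr cedge; apply: known_inj => a; apply/esym/usetP; apply: sub.
  exact/usetP.
- move=> _ [w _ <-]; rewrite usetE card_imfset; last exact: cvert_inj.
  by rewrite /= -cardE.
(* A plausible world with the same knowledge has the given vertex in its tail. *)
- apply/seteqP; split=> // -[[a S] [w /= SE]] _.
  have [w' k pl] := plausible_exists f0 a w.
  exists (cedge w'); first by exists w'.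
  have -> : exist _ (a, S) (ex_intro _ w SE) = cvert w' a.
    by apply: eq_exist; rewrite SE k.
  exact/ctailP.
Qed.

Lemma rel_K_cedge a w w' :
  rel_K (M := cmodel) a (cedge w) (cedge w') <-> known a w = known a w'.
Proof.
split=> [[u /fsetIP[/mem_uset uE /[swap] ca]]|k].
  by rewrite uE [(sval u).1]ca => /usetP.
exists (cvert w a) => //; apply/fsetIP; split; exact/usetP.
Qed.

Lemma rel_B_cedge a w w' :
  rel_B (M := cmodel) a (cedge w) (cedge w') <->
  known a w = known a w' /\ plausible a w'.
Proof.
split=> [[u /fsetIP[/mem_uset uE /[swap] ca]]|[k pl]].
  by rewrite uE [(sval u).1]ca => /ctailP[].
by exists (cvert w a) => //; apply/fsetIP; split; [exact/usetP|exact/ctailP].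
Qed.

(** Induction on [f]: the witness lemmas handle modal formulas outside [w]; conversely, knowledge is
    true, and belief is true at plausible worlds. *)
Lemma truth w f : sat (M := cmodel) (cedge w) f <-> sval w f.
Proof.
elim: f w => [p|f IH|f IHf g IHg|a f IH|a f IH] w /=.
(* The only vertex of the edge that can carry [p] is its owner's, labelled with the atoms of that
   agent known at [w]. *)
- rewrite -atom_known; split=> [[u /= /mem_uset uE [tp]]|kp].
    by rewrite uE /= -[(sval u).1]tp.
  by exists (cvert w (tag p)) => //=; exact/usetP.
- by rewrite IH (mc_Neg (svalP w)).
- by rewrite IHf IHg (mc_And _ _ (svalP w)).
- split=> [h|wB _ [w' _ <-] /rel_B_cedge[k pl]]; last first.
    exact/IH/pl/(believed_known k wB).
  apply: contrapT => /believed_witness[w' [k pl]]; apply; apply/IH.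
  by apply: h; [exists w'|exact/rel_B_cedge].
- split=> [h|wK _ [w' _ <-] /rel_K_cedge k]; last first.
    by apply/IH/(mc_axiom (svalP w') (ax_KT a _)); rewrite -[sval w' _]/(known a w' f) -k.
  apply: contrapT => /known_witness[w' k]; apply; apply/IH.
  by apply: h; [exists w'|exact/rel_K_cedge].
Qed.

End CanonicalModel.

(** * Soundness and completeness *)

Theorem theorem2 (n : nat) (n_ge1 : 1 <= n) (A : finType) (card_A : #|A| = n)
    (Var : A -> countType) (f : form Var) :
  EDL_provable f <-> valid_in (H_sut n) f.
Proof.
subst n; split=> [pf M [_ Mu Mt]|vf].
  elim/provable_ind: f / pf => [f|f g IHfg IHf|a f IHf] E hE.
  - by move=> /(axiom_sound Mu Mt); exact.
  - by move/sat_Imp: (IHfg E hE); apply; exact: IHf.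
  - by move=> E' hE' _; exact: IHf.
apply: contrapT => npf.
have [|w [mw _ nwf]] := @lindenbaum _ _ set0 f.
  (* Entailment from no hypotheses is provability. *)
  by apply: contra_not npf; elim=> {f vf} // f g _ h1 _; exact: provable_MP.
pose W : world Var := exist _ w mw.
(* An agent is needed to exhibit a vertex of the canonical hypergraph. *)
have [a _] := card_gt0P n_ge1.
apply: nwf; apply/(truth (inhabits (cvert W a)) W); apply: vf.
- exact: cmodel_sut f.
- by exists W.
Qed.
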